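(* Let $n$ be a positive integer and let $G$ be a group with $\omega(G)=n$. Then: (1) there are only finitely many groups $H$ with $\omega(H)=n$, up to isoclinism (i.e. the groups $H$ with $\omega(H)=n$ fall into finitely many isoclinism classes); (2) there exists a finite group $K$ such that $K$ is isoclinic to $G$ and $\omega(G)=\omega(K)$.
   Context: A subset $X$ of a group $G$ is a set of pairwise non-commuting elements if $ab\neq ba$ for any two distinct $a,b\in X$. $\omega(G)$ denotes the maximum cardinality of a set of pairwise non-commuting elements of $G$ (the clique number of $G$). Two groups $G$ and $H$ are isoclinic if there are isomorphisms $\varphi: G/Z(G)\to H/Z(H)$ and $\phi: G'\to H'$ (where $Z(\cdot)$ is the center and $G'$ the derived subgroup) such that whenever $\varphi(g_1Z(G))=h_1Z(H)$ and $\varphi(g_2Z(G))=h_2Z(H)$, one has $\phi([g_1,g_2])=[h_1,h_2]$. *)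

(* Defs.v *)
From Stdlib Require Import List.
Import ListNotations.
Set Implicit Arguments.

Record Group := {
  carrier :> Type;
  gmul : carrier -> carrier -> carrier;
  gone : carrier;
  ginv : carrier -> carrier;
  gmulA : forall x y z, gmul x (gmul y z) = gmul (gmul x y) z;
  gmul1 : forall x, gmul gone x = x;
  gmulV : forall x, gmul (ginv x) x = gone
}.

Arguments gmul {g} _ _.
Arguments ginv {g} _.

Section Defs.
Variable G : Group.

Definition comm (a b : G) : G :=
  gmul (gmul (ginv a) (ginv b)) (gmul a b).

Definition in_center (z : G) : Prop := forall x : G, gmul z x = gmul x z.

Definition modZ (x y : G) : Prop := in_center (gmul (ginv x) y).

Inductive derived : G -> Prop :=
| der_comm : forall a b, derived (comm a b)
| der_one : derived (gone G)
| der_mul : forall x y, derived x -> derived y -> derived (gmul x y)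
| der_inv : forall x, derived x -> derived (ginv x).

Definition pairwise_noncommuting (X : list G) : Prop :=
  NoDup X /\
  forall a b, In a X -> In b X -> a <> b -> gmul a b <> gmul b a.

Definition omega_eq (n : nat) : Prop :=
  (exists X : list G, pairwise_noncommuting X /\ length X = n) /\
  (forall X : list G, pairwise_noncommuting X -> length X <= n).

Definition finite_group : Prop := exists l : list G, forall x : G, In x l.

End Defs.

Arguments comm {G} _ _.
Arguments in_center {G} _.
Arguments modZ {G} _ _.
Arguments derived {G} _.

(* G and H are isoclinic.  The isomorphism G/Z(G) -> H/Z(H) is given by a
   map phi : G -> H on representatives inducing a well-defined bijective
   homomorphism of the central quotients; psi : G -> H restricted to G'
   is an isomorphism G' -> H'. *)
Definition isoclinic (G H : Group) : Prop :=
  exists (phi : G -> H) (psi : G -> H),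
    (forall x y : G, modZ (phi (gmul x y)) (gmul (phi x) (phi y))) /\
    (forall x y : G, modZ (phi x) (phi y) <-> modZ x y) /\
    (forall h : H, exists x : G, modZ (phi x) h) /\
    (forall x : G, derived x -> derived (psi x)) /\
    (forall x y : G, derived x -> derived y ->
        psi (gmul x y) = gmul (psi x) (psi y)) /\
    (forall x y : G, derived x -> derived y -> psi x = psi y -> x = y) /\
    (forall h : H, derived h -> exists x : G, derived x /\ psi x = h) /\
    (forall (g1 g2 : G) (h1 h2 : H),
        modZ (phi g1) h1 -> modZ (phi g2) h2 ->
        psi (comm g1 g2) = comm h1 h2).

(* Main.v *)
(* Let X be a maximal pairwise non-commuting set of G. The centre of G is the centraliser
   of X, and Ramsey's theorem then bounds |G/Z(G)| in terms of n: among many elements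
   pairwise distinct modulo Z(G), either n+1 do not commute pairwise, or n+1 commute
   pairwise and their quotients all fail to commute with one and the same x in X, and then
   their left translates by x do not commute pairwise.

   With m = |G/Z(G)|, the transfer G -> Z(G) shows that for e = m! m the map g |-> g^e is
   an endomorphism of G with central values. Let t(i), i in I, represent G/Z(G). In the
   quotient of G * Z^I by the central subgroup generated by the (t(i)^e, e delta_i), the
   subgroup K generated by the (t(i), delta_i) has exponent e, and its elements are products
   of a generator and of powers of m^2 central elements: it is finite, of order bounded in
   terms of n.
   Projecting to G is well defined on commutators, since their Z^I-component vanishes, and
   makes K isoclinic to G. As there are finitely many groups of a given order, both
   assertions follow, the clique number being invariant under isoclinism. *)
Require Import Defs.
From Stdlib Require Import List Arith Lia ZArith Permutation.
From Stdlib Require Import Classical ClassicalEpsilon FunctionalExtensionality PropExtensionality.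
Import ListNotations.
Set Implicit Arguments.
Unset Strict Implicit.

Declare Scope grp_scope.
Local Open Scope grp_scope.
Local Notation "x * y" := (gmul x y) : grp_scope.
Local Notation "x ^-" := (ginv x) (at level 3, format "x ^-") : grp_scope.
Local Notation "1" := (gone _) : grp_scope.

(** * Elementary laws from the left-handed group axioms *)

Section GroupLaws.
Variable G : Group.
Implicit Types x y z : G.

Lemma gmulVr x : x * x^- = 1.
Proof.
  rewrite <- (gmul1 _ (x * x^-)), <- (gmulV _ (x^-)), <- gmulA.
  now rewrite (gmulA _ x^- x), gmulV, gmul1.
Qed.

Lemma gmul1r x : x * 1 = x.
Proof. now rewrite <- (gmulV _ x), gmulA, gmulVr, gmul1. Qed.

Lemma gmulKV x y : x^- * (x * y) = y.
Proof. now rewrite gmulA, gmulV, gmul1. Qed.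

Lemma gmulVK x y : x * (x^- * y) = y.
Proof. now rewrite gmulA, gmulVr, gmul1. Qed.

Lemma gmul_cancel_l x y z : x * y = x * z -> y = z.
Proof. intro H. now rewrite <- (gmulKV x y), H, gmulKV. Qed.

Lemma gmul_cancel_r x y z : y * x = z * x -> y = z.
Proof.
  intro H. now rewrite <- (gmul1r y), <- (gmulVr x), gmulA, H, <- gmulA, gmulVr, gmul1r.
Qed.

Lemma ginvK x : (x^-)^- = x.
Proof. apply (gmul_cancel_l (x := x^-)). now rewrite gmulVr, gmulV. Qed.

Lemma ginvM x y : (x * y)^- = y^- * x^-.
Proof.
  apply (gmul_cancel_l (x := x * y)).
  now rewrite gmulVr, <- gmulA, (gmulA _ y), gmulVr, gmul1, gmulVr.
Qed.

Lemma ginv1 : (gone G)^- = 1.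
Proof. now rewrite <- (gmul1r ((gone G)^-)), gmulV. Qed.
End GroupLaws.

Ltac grp := unfold comm in *; repeat first
  [ rewrite <- gmulA | rewrite gmul1 | rewrite gmul1r | rewrite gmulV
  | rewrite gmulVr | rewrite gmulKV | rewrite gmulVK | rewrite ginvM
  | rewrite ginvK | rewrite ginv1 ]; try reflexivity.

(** * Commutators, congruence modulo the centre, and powers *)

Section Commutation.
Variable G : Group.
Implicit Types x y z a b : G.

Lemma comm_eq1 a b : comm a b = 1 <-> a * b = b * a.
Proof.
  split; intro H.
  - apply (gmul_cancel_l (x := (b * a)^-)). rewrite gmulV, <- H. grp.
  - unfold comm. rewrite H. grp.
Qed.

Lemma ginv_comm a b : (comm a b)^- = comm b a.
Proof. grp. Qed.

Lemma central1 : in_center (gone G).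
Proof. intro x. grp. Qed.

Lemma centralM a b : in_center a -> in_center b -> in_center (a * b).
Proof. intros Ha Hb x. now rewrite <- gmulA, Hb, gmulA, Ha, gmulA. Qed.

Lemma commute_inv a b : a * b = b * a -> a^- * b = b * a^-.
Proof.
  intro H. apply (gmul_cancel_l (x := a)), (gmul_cancel_r (x := a)).
  rewrite <- !gmulA, gmulV, gmul1r, gmulVK. now symmetry.
Qed.

Lemma centralV a : in_center a -> in_center (a^-).
Proof. intros Ha x. now apply commute_inv. Qed.

Lemma modZ_refl a : modZ a a.
Proof. unfold modZ. rewrite gmulV. apply central1. Qed.

Lemma modZ_sym a b : modZ a b -> modZ b a.
Proof. unfold modZ. intro H. apply centralV in H. now rewrite ginvM, ginvK in H. Qed.

Lemma modZ_trans a b c : modZ a b -> modZ b c -> @modZ G a c.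
Proof.
  unfold modZ. intros H K. replace (a^- * c) with ((a^- * b) * (b^- * c)) by grp.
  now apply centralM.
Qed.

Lemma modZP a b : modZ a b <-> exists z, in_center z /\ b = a * z.
Proof.
  split.
  - intro H. exists (a^- * b). split; [exact H | grp].
  - intros (z & Hz & ->). unfold modZ. now rewrite gmulKV.
Qed.

Lemma modZM a a' b b' : modZ a a' -> modZ b b' -> modZ (a * b) (a' * b').
Proof.
  rewrite !modZP. intros (z & Hz & ->) (z' & Hz' & ->).
  exists (z * z'). split; [now apply centralM|].
  rewrite <- !gmulA. f_equal. now rewrite !gmulA, (Hz b).
Qed.

Lemma comm_modZ_l a a' b : modZ a a' -> comm a b = comm a' b.
Proof.
  rewrite modZP. intros (z & Hz & ->). unfold comm.
  rewrite ginvM, <- !gmulA, (Hz b), (centralV Hz _). grp.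
Qed.

Lemma comm_modZ a a' b b' : modZ a a' -> modZ b b' -> comm a b = comm a' b'.
Proof.
  intros Ha Hb. rewrite (comm_modZ_l b Ha).
  now rewrite <- (ginv_comm b a'), (comm_modZ_l a' Hb), ginv_comm.
Qed.

Fixpoint gpow x (n : nat) : G := match n with 0 => 1 | S n => x * gpow x n end.

Lemma gpow_add x m n : gpow x (m + n) = gpow x m * gpow x n.
Proof. induction m as [|m IH]; simpl; [grp | now rewrite IH, gmulA]. Qed.

Lemma gpow_mul x m n : gpow x (m * n) = gpow (gpow x m) n.
Proof.
  rewrite Nat.mul_comm. induction n as [|n IH]; simpl; [easy|].
  now rewrite gpow_add, IH.
Qed.

Lemma gpow1 n : gpow (gone G) n = 1.
Proof. induction n as [|n IH]; simpl; [easy | now rewrite gmul1]. Qed.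

Lemma gpow_central x n : in_center x -> in_center (gpow x n).
Proof. intro H. induction n; simpl; [apply central1 | now apply centralM]. Qed.

Lemma gpow_mulcentral x y n : in_center x -> gpow (x * y) n = gpow x n * gpow y n.
Proof.
  intro H. induction n as [|n IH]; simpl; [grp|].
  rewrite IH, <- !gmulA. f_equal.
  now rewrite !gmulA, (gpow_central n H y).
Qed.
End Commutation.

(** * Ramsey's theorem for lists *)

Inductive subseq (A : Type) : list A -> list A -> Prop :=
| subseq_nil : subseq [] []
| subseq_skip x l l' : subseq l l' -> subseq l (x :: l')
| subseq_keep x l l' : subseq l l' -> subseq (x :: l) (x :: l').

Section Ramsey.
Variable A : Type.
Implicit Types l : list A.

Lemma subseq_incl l l' : subseq l l' -> incl l l'.
Proof.
  intro H. induction H; intros y Hy; simpl in *; [easy| |]; intuition.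
Qed.

Lemma subseq_trans l1 l2 l3 : subseq l1 l2 -> subseq l2 l3 -> subseq l1 l3.
Proof.
  intros H12 H23. revert l1 H12.
  induction H23 as [|x l2 l3 H IH|x l2 l3 H IH]; intros l1 H12; auto.
  - constructor. auto.
  - inversion H12; subst; [apply subseq_skip | apply subseq_keep]; auto.
Qed.

Lemma subseq_ordpairs (P : A -> A -> Prop) l l' :
  subseq l l' -> ForallOrdPairs P l' -> ForallOrdPairs P l.
Proof.
  intro H. induction H as [|x l l' H IH|x l l' H IH]; intro HP; auto.
  - inversion HP; auto.
  - inversion HP as [|? ? H1 H2]; subst. constructor; auto.
    rewrite Forall_forall in *. intros y Hy. apply H1. now apply (subseq_incl H).
Qed.

Lemma subseq_split (P : A -> Prop) l : exists l1 l2,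
  subseq l1 l /\ subseq l2 l /\ (forall x, In x l1 -> P x) /\
  (forall x, In x l2 -> ~ P x) /\ length l = length l1 + length l2.
Proof.
  induction l as [|x l (l1 & l2 & S1 & S2 & H1 & H2 & HL)].
  - exists [], []. repeat split; try constructor; easy.
  - destruct (classic (P x)) as [Hx|Hx].
    + exists (x :: l1), l2. repeat split; try (constructor; assumption); auto.
      * intros y [<-|Hy]; auto.
      * simpl. lia.
    + exists l1, (x :: l2). repeat split; try (constructor; assumption); auto.
      * intros y [<-|Hy]; auto.
      * simpl. lia.
Qed.

Lemma pigeonhole k N (Q : nat -> A -> Prop) l :
  k * N < length l -> (forall x, In x l -> exists c, c < k /\ Q c x) ->
  exists c l', c < k /\ subseq l' l /\ N < length l' /\ forall x, In x l' -> Q c x.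
Proof.
  revert l. induction k as [|k IH]; intros l HL HQ.
  - destruct l as [|x l]; simpl in HL; [lia|].
    destruct (HQ x) as (c & Hc & _); [now left | lia].
  - destruct (subseq_split (Q k) l) as (l1 & l2 & S1 & S2 & H1 & H2 & HL12).
    destruct (le_lt_dec (length l1) N) as [Hle|Hlt].
    + destruct (IH l2) as (c & l' & Hc & Hs & HN & H').
      * simpl in HL. lia.
      * intros x Hx. destruct (HQ x (subseq_incl S2 Hx)) as (c & Hc & Hcx).
        exists c. split; [|easy]. assert (c <> k) by (intros ->; now apply (H2 x)). lia.
      * exists c, l'. repeat split; auto. apply (subseq_trans Hs S2).
    + exists k, l1. repeat split; auto.
Qed.

End Ramsey.

(** The head [a] is kept with a colour [c] that joins it to more than [N] later elements, and the
    construction continues among those; hence each chosen element has one colour towards all later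
    ones. *)
Lemma end_homogeneous k r : exists N, forall (A : Type)
  (R : nat -> A -> A -> Prop) (l : list A),
  N < length l -> ForallOrdPairs (fun x y => exists c, c < k /\ R c x y) l ->
  exists s : list (A * nat), length s = r /\
    (forall p, In p s -> In (fst p) l /\ snd p < k) /\
    ForallOrdPairs (fun p q => R (snd p) (fst p) (fst q)) s.
Proof.
  induction r as [|r [N IH]].
  - exists 0. intros A R l _ _. exists []. repeat split; try easy. constructor.
  - exists (S (k * N)). intros A R l HL HP.
    destruct l as [|a l]; simpl in HL; [lia|].
    inversion HP as [|? ? Ha Hl]; subst. rewrite Forall_forall in Ha.
    destruct (@pigeonhole A k N (fun c x => R c a x) l) as (c & l' & Hc & Hs & HN & H');
      [lia | exact Ha |].
    destruct (IH A R l' HN (subseq_ordpairs Hs Hl)) as (s & Hls & Hin & Hord).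
    exists ((a, c) :: s). repeat split; simpl; auto.
    + destruct H as [<-|Hp]; [now left|]. right. apply (subseq_incl Hs), Hin, Hp.
    + destruct H as [<-|Hp]; [easy|]. apply Hin, Hp.
    + constructor; auto. apply Forall_forall. intros p Hp. apply H', Hin, Hp.
Qed.

(** In the sequence from [end_homogeneous] the colour of a pair is carried by its first element;
    among [k * n + 1] elements, more than [n] carry the same one. *)
Theorem ramsey k n : exists N, forall (A : Type)
  (R : nat -> A -> A -> Prop) (l : list A),
  N < length l -> ForallOrdPairs (fun x y => exists c, c < k /\ R c x y) l ->
  exists c l', c < k /\ n < length l' /\ ForallOrdPairs (R c) l'.
Proof.
  destruct (end_homogeneous k (S (k * n))) as [N HN]. exists N. intros A R l HL HP.
  destruct (HN A R l HL HP) as (s & Hs & Hin & Hord).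
  destruct (@pigeonhole _ k n (fun c p => snd p = c) s) as (c & s' & Hc & Hsub & Hn & Hcol).
  - lia.
  - intros p Hp. exists (snd p). split; [apply Hin, Hp | easy].
  - exists c, (map fst s'). rewrite length_map. repeat split; auto.
    apply (subseq_ordpairs Hsub) in Hord. clear - Hord Hcol.
    induction Hord as [|p s' H _ IH]; simpl; constructor.
    + rewrite Forall_forall in *. intros x Hx. apply in_map_iff in Hx.
      destruct Hx as (q & <- & Hq). rewrite <- (Hcol p) by now left. now apply H.
    + apply IH. intros q Hq. apply Hcol. now right.
Qed.

(** * The central quotient *)

Section Clique.
Variable G : Group.
Implicit Types X l : list G.

Lemma noncommuting_ordpairs l :
  ForallOrdPairs (fun a b : G => a * b <> b * a) l -> pairwise_noncommuting G l.
Proof.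
  intro H. split.
  - induction H as [|a l Ha H IH]; constructor; auto. intro Hin.
    rewrite Forall_forall in Ha. now apply (Ha a).
  - intros a b Ha Hb Hab. destruct (ForallOrdPairs_In H a b Ha Hb) as [?|[?|?]]; auto.
Qed.

(* If [d] centralises [X] but not [g], replacing each [x] of [X] commuting with [g] by
   [x * d] keeps [X] pairwise non-commuting, and [g] can then be added to it. *)
Lemma center_of_clique n X : pairwise_noncommuting G X -> length X = n ->
  (forall Y, pairwise_noncommuting G Y -> length Y <= n) ->
  forall d : G, (forall x, In x X -> d * x = x * d) -> in_center d.
Proof.
  intros [HX HXc] Hn Hmax d Hd g. apply NNPP. intro Hdg.
  set (p := fun x : G => if excluded_middle_informative (g * x = x * g) then d else 1).
  assert (Hp : forall x, p x = d \/ p x = 1).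
  { intro x. unfold p. destruct excluded_middle_informative; auto. }
  assert (Hpx : forall x y, In x X -> p y * x = x * p y).
  { intros x y Hx. destruct (Hp y) as [->| ->]; [now apply Hd | grp]. }
  assert (Hpp : forall x y, p x * p y = p y * p x).
  { intros x y. destruct (Hp x) as [->| ->], (Hp y) as [->| ->]; grp. }
  assert (Hnc : forall x y, In x X -> In y X ->
     (x * p x) * (y * p y) = (y * p y) * (x * p x) -> x * y = y * x).
  (* The factors [p x] commute with [X] and with one another, so they cancel from such a
     relation. *)
  { intros x y Hx Hy H.
    apply (gmul_cancel_r (x := p x * p y)).
    replace ((x * y) * (p x * p y)) with ((x * p x) * (y * p y)).
    - rewrite H, (Hpp x y), <- !gmulA. f_equal.
      now rewrite !gmulA, (Hpx x y).
    - rewrite <- !gmulA. f_equal. now rewrite !gmulA, (Hpx y x). }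
  (* If [g] commutes with [x], then commuting with [x * d] would make it commute with [d], against
     [Hdg]. *)
  assert (Hng : forall x, In x X -> g * (x * p x) <> (x * p x) * g).
  { intros x Hx. unfold p. destruct excluded_middle_informative as [E|E].
    - rewrite gmulA, E, <- !gmulA. intro H. apply gmul_cancel_l in H. now apply Hdg.
    - now rewrite gmul1r. }
  enough (Hbig : length (g :: map (fun x => x * p x) X) <= n).
  { simpl in Hbig. rewrite length_map in Hbig. lia. }
  apply Hmax, noncommuting_ordpairs. constructor.
  - apply Forall_forall. intros y Hy. apply in_map_iff in Hy.
    destruct Hy as (x & <- & Hx). now apply Hng.
  - clear Hn. assert (Hi : incl X X) by easy. revert HX Hi. generalize X at 1 2 4.
    intros Y HY. induction HY as [|x Y Hx HY IH]; intro Hi; simpl; constructor.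
    + apply Forall_forall. intros y Hy. apply in_map_iff in Hy.
      destruct Hy as (x' & <- & Hx'). intro H. apply Hnc in H; auto using in_eq, in_cons.
      revert H. apply HXc; auto using in_eq, in_cons. now intros ->.
    + apply IH. intros y Hy. apply Hi. now right.
Qed.
End Clique.

Lemma central_quotient_bound n : exists N, forall (G : Group) (l : list G),
  omega_eq G n -> ForallOrdPairs (fun a b => ~ modZ a b) l -> length l <= N.
Proof.
  destruct (ramsey (S n) n) as [N HN]. exists N.
  intros G l [(X & HX & HXn) Hmax] Hl.
  destruct (le_lt_dec (length l) N) as [|Hlt]; [easy|exfalso].
  (* Colour 0 marks non-commuting pairs; colour [S j] marks commuting pairs whose quotient fails to
     commute with the [j]-th element of [X]. As [length X = n], this makes [S n] colours. *)
  destruct (HN G (fun c a b => match c with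
      | 0 => a * b <> b * a
      | S j => a * b = b * a /\ (a^- * b) * nth j X 1 <> nth j X 1 * (a^- * b) end) l)
    as (c & l' & Hc & Hn & Hl'); auto.
  - clear - Hl HX HXn Hmax. induction Hl as [|a l Ha Hl IH]; constructor; auto.
    rewrite Forall_forall in *. intros b Hb. specialize (Ha b Hb).
    destruct (classic (a * b = b * a)) as [Hab|Hab]; [|exists 0; split; [lia|easy]].
    apply NNPP. intro Hno. apply Ha.
    apply (center_of_clique HX HXn Hmax). intros x Hx. apply NNPP. intro Hxd.
    destruct (In_nth _ _ 1 Hx) as (j & Hj & <-). apply Hno.
    exists (S j). split; [lia|easy].
  - destruct c as [|j].
    + apply noncommuting_ordpairs, Hmax in Hl'. lia.
    + enough (Hm : length (map (gmul (nth j X 1)) l') <= n) by (rewrite length_map in Hm; lia).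
      apply Hmax, noncommuting_ordpairs. generalize (nth j X 1) Hl'. clear. intros x H.
      induction H as [|a l Ha H IH]; simpl; constructor; auto.
      rewrite Forall_forall in *. intros y Hy. apply in_map_iff in Hy.
      destruct Hy as (b & <- & Hb). destruct (Ha b Hb) as [Hab Hx].
      (* Cancelling the first [x] leaves [a * x * b = b * x * a]; since [a] and [b] commute, this
         says that [x] commutes with [a^- * b]. *)
      intro E. apply Hx. rewrite <- !gmulA in E. apply gmul_cancel_l in E.
      rewrite (commute_inv Hab) at 2.
      apply (gmul_cancel_l (x := a)), (gmul_cancel_r (x := a)). grp. now symmetry.
Qed.

(** * Power endomorphisms from the transfer *)

Section Transfer.
Variable G : Group.
Implicit Types g h : G.

Definition gprod (l : list G) : G := fold_right gmul 1 l.

Lemma gprod_central l : (forall x, In x l -> in_center x) -> in_center (gprod l).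
Proof.
  induction l as [|a l IH]; intro H; simpl; [apply central1|].
  apply centralM; auto using in_eq, in_cons.
Qed.

Lemma gprod_perm l l' : Permutation l l' -> (forall x, In x l -> in_center x) ->
  gprod l = gprod l'.
Proof.
  intro H. induction H as [|x l l' H IH|x y l|l1 l2 l3 H1 IH1 H2 IH2]; intro Hc; simpl.
  - easy.
  - rewrite IH; auto using in_cons.
  - rewrite !gmulA. f_equal. apply Hc, in_eq.
  - rewrite IH1, IH2; auto. intros x Hx. apply Hc.
    now apply (Permutation_in _ (Permutation_sym H1)).
Qed.

Lemma gprod_map_mul (B : Type) (f1 f2 : B -> G) (l : list B) :
  (forall y, In y l -> in_center (f2 y)) ->
  gprod (map (fun y => f1 y * f2 y) l) = gprod (map f1 l) * gprod (map f2 l).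
Proof.
  induction l as [|y l IH]; intro H; simpl; [grp|].
  rewrite IH by auto using in_cons. rewrite <- !gmulA. f_equal.
  rewrite !gmulA. f_equal. apply H, in_eq.
Qed.

Lemma gprod_map_const (B : Type) (z : G) (l : list B) :
  gprod (map (fun _ => z) l) = gpow z (length l).
Proof. induction l; simpl; congruence. Qed.

Variables (rep : G -> G) (T : list G).
Hypothesis rep_modZ : forall g, modZ (rep g) g.
Hypothesis rep_eq : forall g h, modZ g h -> rep g = rep h.
Hypothesis T_uniq : NoDup T.
Hypothesis T_rep : forall g, In (rep g) T.
Hypothesis rep_T : forall g, In g T -> rep g = g.

Let shift g y : G := (rep (g * y))^- * (g * y).
(** The transfer of [G] into its centre relative to the transversal [T]; all factors are central, so
    their order is immaterial. *)
Definition transfer g : G := gprod (map (shift g) T).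

Let shift_central g y : in_center (shift g y).
Proof. exact (rep_modZ (g * y)). Qed.

Lemma transfer_central g : in_center (transfer g).
Proof.
  apply gprod_central. intros x Hx. apply in_map_iff in Hx.
  destruct Hx as (y & <- & _). apply shift_central.
Qed.

(** Left multiplication by [h] permutes the cosets of the centre, each of which has exactly one
    representative in [T]. *)
Lemma rep_mul_perm h : Permutation (map (fun y => rep (h * y)) T) T.
Proof.
  apply NoDup_Permutation_bis.
  - assert (Hinj : forall y y', In y T -> In y' T -> rep (h * y) = rep (h * y') -> y = y').
    { intros y y' Hy Hy' E. rewrite <- (rep_T Hy), <- (rep_T Hy'). apply rep_eq.
      assert (M : modZ (h * y) (h * y')).
      { apply modZ_trans with (rep (h * y)); [apply modZ_sym, rep_modZ|].
        rewrite E. apply rep_modZ. }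
      apply (modZM (modZ_refl (h^-))) in M. now rewrite !gmulKV in M. }
    revert Hinj. generalize T_uniq. generalize T. clear. intros T HT Hinj.
    induction HT as [|y T Hy HT IH]; simpl; constructor.
    + intro H. apply in_map_iff in H. destruct H as (y' & E & Hy').
      apply Hinj in E; auto using in_eq, in_cons. congruence.
    + apply IH. intros; apply Hinj; auto using in_cons.
  - now rewrite length_map.
  - intros x Hx. apply in_map_iff in Hx. destruct Hx as (y & <- & _). apply T_rep.
Qed.

Lemma transferM g h : transfer (g * h) = transfer g * transfer h.
Proof.
  unfold transfer.
  (* Once the product for [g] is reindexed by [y |-> rep (h * y)], the cocycle identity [shift (g *
     h) y = shift g (rep (h * y)) * shift h y] matches the factors. *)
  replace (gprod (map (shift g) T)) with (gprod (map (shift g) (map (fun y => rep (h * y)) T))).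
  - rewrite map_map, <- gprod_map_mul by (intros; apply shift_central).
    f_equal. apply map_ext. intro y. unfold shift.
    rewrite <- !gmulA, gmulVK. f_equal. f_equal. apply rep_eq.
    apply modZM; [apply modZ_refl | apply modZ_sym, rep_modZ].
  - apply gprod_perm; [apply Permutation_map, rep_mul_perm|].
    intros x Hx. apply in_map_iff in Hx. destruct Hx as (y & <- & _). apply shift_central.
Qed.

Lemma transfer_on_center z : in_center z -> transfer z = gpow z (length T).
Proof.
  intro Hz. unfold transfer. rewrite <- gprod_map_const. f_equal.
  apply map_ext_in. intros y Hy. unfold shift.
  rewrite (Hz y). replace (rep (y * z)) with y; [grp|].
  rewrite <- (rep_T Hy) at 1. apply rep_eq, modZP. now exists z.
Qed.

Lemma transfer_pow g k : transfer (gpow g k) = gpow (transfer g) k.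
Proof.
  induction k as [|k IH]; simpl; [|now rewrite transferM, IH].
  rewrite transfer_on_center by apply central1. apply gpow1.
Qed.

(** Two of the powers with exponents [0] to [length T] are congruent modulo the centre, so
    [gpow g d] is central for some [d] between 1 and [length T], and such a [d] divides the
    factorial. *)
Lemma pow_fact_central g : in_center (gpow g (fact (length T))).
Proof.
  assert (H : exists i j, i < j /\ j <= length T /\ rep (gpow g i) = rep (gpow g j)).
  { apply NNPP. intro H.
    assert (L : length (map (fun i => rep (gpow g i)) (seq 0 (S (length T)))) <= length T).
    { apply NoDup_incl_length.
      - apply NoDup_map_NoDup_ForallPairs; [|apply seq_NoDup].
        intros i j Hi Hj E. apply in_seq in Hi, Hj.
        destruct (lt_eq_lt_dec i j) as [[Hij|Hij]|Hij]; [|easy|];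
        exfalso; apply H; [exists i, j | exists j, i]; repeat split; auto; lia.
      - intros x Hx. apply in_map_iff in Hx. destruct Hx as (i & <- & _). apply T_rep. }
    rewrite length_map, length_seq in L. lia. }
  destruct H as (i & j & Hij & Hj & E).
  assert (Hd : in_center (gpow g (j - i))).
  { assert (M : modZ (gpow g i) (gpow g j)).
    { apply modZ_trans with (rep (gpow g i)); [apply modZ_sym, rep_modZ|].
      rewrite E. apply rep_modZ. }
    unfold modZ in M. rewrite <- (Nat.sub_add i j), Nat.add_comm in M by lia.
    rewrite gpow_add, gmulKV in M. exact M. }
  assert (Hdiv : Nat.divide (j - i) (fact (length T))).
  { assert (1 <= j - i <= length T) as Hr by lia. revert Hr. generalize (j - i) (length T).
    intros d m. induction m as [|m IH]; intro Hr; [lia|].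
    destruct (Nat.eq_dec d (S m)) as [->|Hne].
    - exists (fact m). simpl. lia.
    - change (fact (S m)) with (S m * fact m)%nat. apply Nat.divide_mul_r, IH. lia. }
  destruct Hdiv as [q ->]. rewrite Nat.mul_comm, gpow_mul. now apply gpow_central.
Qed.

Let e := (fact (length T) * length T)%nat.

(** With [m = length T], the power of [g] of exponent [m!] is central, so its [m]-th power is its
    transfer, that is, the [m!]-th power of the transfer of [g]. *)
Lemma gpow_transfer g : gpow g e = gpow (transfer g) (fact (length T)).
Proof.
  unfold e. rewrite gpow_mul, <- transfer_on_center by apply pow_fact_central.
  apply transfer_pow.
Qed.

Lemma gpow_exp_central g : in_center (gpow g e).
Proof. rewrite gpow_transfer. apply gpow_central, transfer_central. Qed.

Lemma gpow_expM g h : gpow (g * h) e = gpow g e * gpow h e.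
Proof.
  rewrite !gpow_transfer, transferM. apply gpow_mulcentral, transfer_central.
Qed.
End Transfer.

Lemma choose_fun (A B : Type) (R : A -> B -> Prop) :
  (forall x, exists y, R x y) -> exists f, forall x, R x (f x).
Proof.
  intro H. exists (fun x => proj1_sig (constructive_indefinite_description _ (H x))).
  intro x. apply proj2_sig.
Qed.

(** A pairwise incongruent list of maximal length meets every coset of the centre; lengths are
    bounded by [N], so one exists. *)
Lemma exists_transversal (G : Group) N :
  (forall l : list G, ForallOrdPairs (fun a b => ~ modZ a b) l -> length l <= N) ->
  exists (rep : G -> G) (T : list G), length T <= N /\
    (forall g, modZ (rep g) g) /\ (forall g h, modZ g h -> rep g = rep h) /\
    NoDup T /\ (forall g, In (rep g) T) /\ (forall g, In g T -> rep g = g).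
Proof.
  intro HN.
  assert (Hmax : exists T : list G, ForallOrdPairs (fun a b => ~ modZ a b) T /\
    forall l : list G, ForallOrdPairs (fun a b => ~ modZ a b) l -> length l <= length T).
  { apply NNPP. intro Hno.
    assert (Hbig : forall k, exists l : list G,
      ForallOrdPairs (fun a b => ~ modZ a b) l /\ k <= length l).
    { induction k as [|k (l & Hl & Hk)].
      - exists []. split; [constructor | easy].
      - apply NNPP. intro Hk'. apply Hno. exists l. split; auto.
        intros l' Hl'. destruct (le_lt_dec (length l') (length l)); auto.
        exfalso. apply Hk'. exists l'. split; [auto | lia]. }
    destruct (Hbig (S N)) as (l & Hl & Hk). apply HN in Hl. lia. }
  destruct Hmax as (T & HT & Hmax).
  assert (Hrep : forall g : G, exists t, In t T /\ modZ t g).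
  { intro g. apply NNPP. intro Hno.
    enough (length (g :: T) <= length T) by (simpl in *; lia).
    apply Hmax. constructor; auto. apply Forall_forall. intros t Ht H.
    apply Hno. exists t. split; [easy | now apply modZ_sym]. }
  destruct (choose_fun Hrep) as [rep Hr].
  assert (Huniq : forall t t' : G, In t T -> In t' T -> modZ t t' -> t = t').
  { intros t t' Ht Ht' H. destruct (ForallOrdPairs_In HT t t' Ht Ht') as [?|[?|?]]; auto.
    - easy.
    - now apply modZ_sym in H. }
  exists rep, T. repeat split; try (intros; apply Hr); auto.
  - intros g h H. apply Huniq; try apply Hr. apply modZ_trans with g; [apply Hr|].
    apply modZ_trans with h; [easy|]. apply modZ_sym, Hr.
  - clear - HT. induction HT as [|t T Ht HT IH]; constructor; auto.
    intro Hin. rewrite Forall_forall in Ht. apply (Ht t Hin), modZ_refl.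
  - intros g Hg. apply Huniq; auto; apply Hr.
Qed.

Lemma central_power_hom n : exists M, forall G : Group, omega_eq G n ->
  exists (T : list G) e, length T <= M /\ 0 < e <= M /\
    (forall g : G, exists t, In t T /\ modZ t g) /\
    (forall g : G, in_center (gpow g e)) /\
    (forall g h : G, gpow (g * h) e = gpow g e * gpow h e).
Proof.
  (* Both the size [m <= N] of the transversal and the exponent [m! * m] are at most [N! * N]. *)
  destruct (central_quotient_bound n) as [N HN]. exists (fact N * N)%nat.
  intros G HG.
  destruct (exists_transversal (fun l => HN G l HG)) as (rep & T & HTN & H1 & H2 & H3 & H4 & H5).
  exists T, (fact (length T) * length T)%nat.
  assert (0 < length T) by (specialize (H4 1); destruct T; simpl; [easy | lia]).
  pose proof (lt_O_fact (length T)). pose proof (lt_O_fact N).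
  pose proof (fact_le _ _ HTN).
  repeat split; [nia|nia|nia| | |].
  - intro g. exists (rep g). auto.
  - apply (gpow_exp_central H1 H2 H3 H4 H5).
  - apply (gpow_expM H1 H2 H3 H4 H5).
Qed.

(** * Isoclinism through relations *)

Section Relations.
Variables G H : Group.

(** For a subgroup [r] of the product of [G] and [H], this is its derived subgroup, viewed again as
    a relation. *)
Inductive rel_derived (r : G -> H -> Prop) : G -> H -> Prop :=
| rder_comm a b a' b' : r a a' -> r b b' -> rel_derived r (comm a b) (comm a' b')
| rder_one : rel_derived r 1 1
| rder_mul x y x' y' : rel_derived r x x' -> rel_derived r y y' ->
    rel_derived r (x * y) (x' * y')
| rder_inv x x' : rel_derived r x x' -> rel_derived r (x^-) (x'^-).

(* A subgroup of [G * H] both of whose projections cover the central quotient, and whose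
   derived subgroup is the graph of an injective function. *)
Record isoclinism (r : G -> H -> Prop) : Prop := {
  isoc_mul : forall x y x' y', r x x' -> r y y' -> r (x * y) (x' * y');
  isoc_inv : forall x x', r x x' -> r (x^-) (x'^-);
  isoc_l : forall g, exists h g', modZ g g' /\ r g' h;
  isoc_r : forall h, exists g h', modZ h h' /\ r g h';
  isoc_der : forall x y, rel_derived r x y -> x = 1 <-> y = 1
}.
End Relations.

Lemma rel_derived_sym (G H : Group) (r : G -> H -> Prop) x y :
  rel_derived r x y -> rel_derived (fun h g => r g h) y x.
Proof. induction 1; now constructor. Qed.

Lemma isoclinism_sym (G H : Group) (r : G -> H -> Prop) :
  isoclinism r -> isoclinism (fun h g => r g h).
Proof.
  intros [Hm Hi Hl Hr Hd]. constructor; auto.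
  intros x y D. symmetry. apply Hd. now apply rel_derived_sym in D.
Qed.

(** Used to exchange each finite group for an isomorphic one in a fixed finite list. *)
Lemma isoclinism_trans_iso (G H K : Group) (r : G -> H -> Prop) (f : H -> K) :
  isoclinism r -> (forall x y, f (x * y) = f x * f y) ->
  (forall x y, f x = f y -> x = y) -> (forall z, exists x, f x = z) ->
  isoclinism (fun g k => exists h, r g h /\ f h = k).
Proof.
  intros [Hm Hi Hl Hr Hd] fM finj fsurj.
  assert (f1 : f 1 = 1).
  { apply (gmul_cancel_l (x := f 1)). rewrite <- fM. grp. }
  assert (fV : forall x, f (x^-) = (f x)^-).
  { intro x. apply (gmul_cancel_l (x := f x)). rewrite <- fM, !gmulVr. exact f1. }
  constructor.
  - intros x y ? ? (h & Hh & <-) (h' & Hh' & <-). exists (h * h'). auto.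
  - intros x ? (h & Hh & <-). exists (h^-). auto.
  - intro g. destruct (Hl g) as (h & g' & Hg & Hh). exists (f h), g'. eauto.
  - intro k. destruct (fsurj k) as [h <-]. destruct (Hr h) as (g & h' & Hh & Hg).
    exists g, (f h'). split; [|eauto]. unfold modZ in *. intro k.
    destruct (fsurj k) as [x <-]. rewrite <- fV, <- !fM. f_equal. apply Hh.
  - intros x k D.
    assert (E : exists h, rel_derived r x h /\ f h = k).
    { induction D as [a b ? ? (a' & Ha & <-) (b' & Hb & <-)| |
        x y ? ? D (h & Hh & <-) D' (h' & Hh' & <-)|x ? D (h & Hh & <-)].
      - exists (comm a' b'). split; [now constructor|]. unfold comm. now rewrite !fM, !fV.
      - exists 1. split; [constructor | easy].
      - exists (h * h'). split; [now constructor | easy].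
      - exists (h^-). split; [now constructor | easy]. }
    destruct E as (h & Hh & <-). rewrite (Hd _ _ Hh). split; [now intros ->|].
    rewrite <- f1. apply finj.
Qed.

(** * Commuting, centres and cliques along an isoclinism *)

Section IsoclinismTheory.
Variables (G H : Group) (r : G -> H -> Prop).
Hypothesis Hr : isoclinism r.

Lemma isoc_comm x y x' y' : r x x' -> r y y' -> x * y = y * x <-> x' * y' = y' * x'.
Proof.
  intros Hx Hy. rewrite <- !comm_eq1. apply (isoc_der Hr). now constructor.
Qed.

(** The quotient of the two pairs is [(1, y^- * y')], and [isoc_der] makes its second entry
    trivial. *)
Lemma rel_derived_fun x y y' : rel_derived r x y -> rel_derived r x y' -> y = y'.
Proof.
  intros D D'. pose proof (rder_mul (rder_inv D) D') as E.
  apply (isoc_der Hr) in E. rewrite gmulV in E.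
  apply (gmul_cancel_l (x := y^-)). rewrite gmulV. symmetry. now apply E.
Qed.

Lemma rel_derived_r x y : rel_derived r x y -> derived y.
Proof. induction 1; now constructor. Qed.

Lemma rel_derived_total x : derived x -> exists y, rel_derived r x y.
Proof.
  induction 1 as [a b| |x y _ [x' Hx] _ [y' Hy]|x _ [x' Hx]].
  - destruct (isoc_l Hr a) as (a'' & a' & Ha & Ra), (isoc_l Hr b) as (b'' & b' & Hb & Rb).
    rewrite (comm_modZ Ha Hb). exists (comm a'' b''). now constructor.
  - exists 1. constructor.
  - exists (x' * y'). now constructor.
  - exists (x'^-). now constructor.
Qed.

Lemma isoc_center x y : r x y -> in_center x -> in_center y.
Proof.
  intros Hxy Hx h. destruct (isoc_r Hr h) as (g & h' & Hh & Hg).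
  apply comm_eq1. rewrite (comm_modZ (modZ_refl y) Hh). apply comm_eq1.
  apply (isoc_comm Hxy Hg), Hx.
Qed.

Lemma isoc_modZ x y x' y' : r x x' -> r y y' -> modZ x y -> modZ x' y'.
Proof.
  intros Hx Hy. apply isoc_center. apply (isoc_mul Hr); auto. now apply (isoc_inv Hr).
Qed.

Lemma clique_transport (X : list G) : pairwise_noncommuting G X ->
  exists Y : list H, pairwise_noncommuting H Y /\ length Y = length X.
Proof.
  intros [HX Hc]. destruct (choose_fun (isoc_l Hr)) as [f Hf].
  (* [f] reflects commuting. Hence it keeps pairs non-commuting, and in particular distinct. *)
  assert (Hfc : forall a b, f a * f b = f b * f a -> a * b = b * a).
  { intros a b E. destruct (Hf a) as (a' & Ha & Ra), (Hf b) as (b' & Hb & Rb).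
    apply comm_eq1. rewrite (comm_modZ Ha Hb). apply comm_eq1. now apply (isoc_comm Ra Rb). }
  exists (map f X). rewrite length_map. split; [|easy]. split.
  - apply NoDup_map_NoDup_ForallPairs; auto. intros a b Ha Hb E.
    apply NNPP. intro Hab. apply (Hc a b Ha Hb Hab), Hfc. now rewrite E.
  - intros u v Ha Hb. apply in_map_iff in Ha, Hb.
    destruct Ha as (a & <- & Ha), Hb as (b & <- & Hb). intros Hab E.
    apply Hfc in E. revert E. apply Hc; auto. now intros ->.
Qed.
End IsoclinismTheory.

Lemma isoclinism_omega (G H : Group) (r : G -> H -> Prop) n :
  isoclinism r -> omega_eq G n -> omega_eq H n.
Proof.
  intros Hr [(X & HX & HXn) Hmax]. split.
  - destruct (clique_transport Hr HX) as (Y & HY & HYn). exists Y. split; congruence.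
  - intros Y HY. destruct (clique_transport (isoclinism_sym Hr) HY) as (X' & HX' & <-).
    now apply Hmax.
Qed.

Lemma isoclinism_isoclinic (G H : Group) (r : G -> H -> Prop) :
  isoclinism r -> isoclinic G H.
Proof.
  intro Hr. pose proof (isoclinism_sym Hr) as Hs.
  destruct (choose_fun (isoc_l Hr)) as [phi Hphi].
  (* [psi] follows the derived relation on the derived subgroup; elsewhere its value is
     arbitrary. *)
  assert (Hpsi : forall x : G, exists y, derived x -> rel_derived r x y).
  { intro x. destruct (classic (derived x)) as [D|D]; [|now exists 1].
    destruct (rel_derived_total Hr D) as [y Hy]. now exists y. }
  destruct (choose_fun Hpsi) as [psi Hd]. exists phi, psi.
  assert (Hmod : forall x y x' y', r x x' -> r y y' -> modZ x y <-> modZ x' y').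
  { intros. split; [now apply (isoc_modZ Hr) | now apply (isoc_modZ Hs)]. }
  repeat split.
  - intros x y. destruct (Hphi x) as (x' & Mx & Rx), (Hphi y) as (y' & My & Ry),
      (Hphi (x * y)) as (z & Mz & Rz).
    apply (Hmod _ _ _ _ Rz (isoc_mul Hr Rx Ry)).
    apply modZ_trans with (x * y); [now apply modZ_sym | now apply modZM].
  - destruct (Hphi x) as (x' & Mx & Rx), (Hphi y) as (y' & My & Ry). intro M.
    apply (Hmod _ _ _ _ Rx Ry) in M. eauto using modZ_trans, modZ_sym.
  - destruct (Hphi x) as (x' & Mx & Rx), (Hphi y) as (y' & My & Ry). intro M.
    apply (Hmod _ _ _ _ Rx Ry). eauto using modZ_trans, modZ_sym.
  - intro h. destruct (isoc_r Hr h) as (g & h' & Hh & Hg). exists g.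
    destruct (Hphi g) as (g' & Mg & Rg).
    apply modZ_trans with h'; [|now apply modZ_sym].
    apply (Hmod _ _ _ _ Rg Hg). now apply modZ_sym.
  - intros x Hx. now apply (rel_derived_r (Hd x Hx)).
  - intros x y Hx Hy. apply (rel_derived_fun Hr (x := x * y)).
    + apply Hd. now constructor.
    + constructor; auto.
  - intros x y Hx Hy E. pose proof (rel_derived_sym (Hd x Hx)) as Dx.
    rewrite E in Dx. apply (rel_derived_fun Hs Dx), rel_derived_sym, Hd, Hy.
  - intros h Hh. destruct (rel_derived_total Hs Hh) as [x Hx].
    pose proof (rel_derived_r Hx) as Dx. exists x. split; auto.
    apply (rel_derived_fun Hr (Hd x Dx)). now apply rel_derived_sym in Hx.
  - intros g1 g2 h1 h2 M1 M2. rewrite <- (comm_modZ M1 M2).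
    destruct (Hphi g1) as (g1' & N1 & R1), (Hphi g2) as (g2' & N2 & R2).
    apply (rel_derived_fun Hr (Hd (comm g1 g2) (der_comm _ _ _))).
    rewrite (comm_modZ N1 N2). now constructor.
Qed.

(** * A finite group in each isoclinism class *)

Lemma sig_eq (A : Type) (P : A -> Prop) x y (Hx : P x) (Hy : P y) :
  x = y -> exist P x Hx = exist P y Hy.
Proof. intros ->. f_equal. apply proof_irrelevance. Qed.

(** The group axioms are assumed only up to the congruence [R], as they hold for words. Elements of
    [K] are the classes of [R], taken as predicates so that extensionality turns [R] into
    equality. *)
Lemma quotient_group (W : Type) (mul : W -> W -> W) (one : W) (inv : W -> W)
    (R : W -> W -> Prop) :
  (forall a, R a a) -> (forall a b, R a b -> R b a) ->
  (forall a b c, R a b -> R b c -> R a c) ->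
  (forall a a' b b', R a a' -> R b b' -> R (mul a b) (mul a' b')) ->
  (forall a b c, R (mul a (mul b c)) (mul (mul a b) c)) ->
  (forall a, R (mul one a) a) -> (forall a, R (mul (inv a) a) one) ->
  exists (K : Group) (p : W -> K), (forall k, exists w, p w = k) /\
    (forall a b, p (mul a b) = p a * p b) /\ (forall a b, p a = p b <-> R a b).
Proof.
  intros Rrefl Rsym Rtrans Rmul RA R1 RV.
  set (C := {S : W -> Prop | exists a, S = R a}).
  set (p := fun a : W => exist _ (R a) (ex_intro _ a eq_refl) : C).
  assert (pE : forall a b, p a = p b <-> R a b).
  { intros a b. split.
    - intro E. apply (f_equal (@proj1_sig _ _)) in E. simpl in E. rewrite E. apply Rrefl.
    - intro H. unfold p. apply sig_eq. apply functional_extensionality. intro c.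
      apply propositional_extensionality. split; intro; eauto. }
  assert (psurj : forall k : C, exists a, p a = k).
  { intros [S [a ->]]. now exists a. }
  destruct (choose_fun psurj) as [s Hs].
  assert (sp : forall a, R (s (p a)) a) by (intro a; apply pE, Hs).
  assert (pM : forall a b, p (mul (s (p a)) (s (p b))) = p (mul a b)).
  { intros a b. apply pE. auto. }
  unshelve eexists (@Build_Group C (fun k l => p (mul (s k) (s l))) (p one)
    (fun k => p (inv (s k))) _ _ _).
  - intros x y z. apply pE. eauto 7.
  - intro x. rewrite <- (Hs x) at 2. apply pE. eauto.
  - intro x. apply pE. eauto.
  - exists p. split; [exact psurj|]. split; [|exact pE]. intros a b. simpl. now rewrite pM.
Qed.

(** * Words in generators and their exponent sums *)

Section Words.
Variable I : Type.
Notation word := (list (I * bool)).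

Fixpoint ev (G : Group) (t : I -> G) (w : word) : G :=
  match w with
  | [] => 1
  | (i, b) :: w => (if b then t i else (t i)^-) * ev t w
  end.

(** The exponent-sum vector of [w] in [Z^I], paired with [f]; quantifying over all [f] recovers the
    vector without writing its coordinates. *)
Fixpoint wsum (f : I -> Z) (w : word) : Z :=
  match w with
  | [] => 0
  | (i, b) :: w => (if b then f i else - f i) + wsum f w
  end%Z.

Definition winv (w : word) : word := rev (map (fun l => (fst l, negb (snd l))) w).

Fixpoint wpow (w : word) (n : nat) : word :=
  match n with 0 => [] | S n => w ++ wpow w n end.

Lemma wsum_app f u v : wsum f (u ++ v) = (wsum f u + wsum f v)%Z.
Proof. induction u as [|[i b] u IH]; simpl; lia. Qed.

Lemma wsum_inv f w : wsum f (winv w) = (- wsum f w)%Z.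
Proof.
  unfold winv. induction w as [|[i []] w IH]; simpl; rewrite ?wsum_app; simpl; lia.
Qed.

Lemma wsum_pow f w n : wsum f (wpow w n) = (Z.of_nat n * wsum f w)%Z.
Proof. induction n as [|n IH]; simpl wpow; rewrite ?wsum_app; simpl wsum; lia. Qed.

Section Eval.
Variables (G : Group) (t : I -> G).

Lemma ev_app u v : ev t (u ++ v) = ev t u * ev t v.
Proof. induction u as [|[i b] u IH]; simpl; [grp|]. now rewrite IH, gmulA. Qed.

Lemma ev_inv w : ev t (winv w) = (ev t w)^-.
Proof.
  unfold winv. induction w as [|[i []] w IH]; simpl; rewrite ?ev_app, ?IH; simpl; grp.
Qed.

Lemma ev_pow w n : ev t (wpow w n) = gpow (ev t w) n.
Proof. induction n as [|n IH]; simpl; [easy|]. now rewrite ev_app, IH. Qed.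

(** Central letters commute, so a word with zero exponent sums cancels completely: the inverse of
    its first letter occurs later, and both can be removed. *)
Lemma ev_central_wsum0 u : (forall i, in_center (t i)) ->
  (forall f, wsum f u = 0%Z) -> ev t u = 1.
Proof.
  intros Ht. assert (Hb : forall (i : I) (b : bool), in_center (if b then t i else (t i)^-)).
  { intros i []; [apply Ht | apply centralV, Ht]. }
  remember (length u) as n eqn:Hn. revert u Hn.
  induction n as [n IH] using lt_wf_ind. intros [|[i b] u] Hn Hu; [easy|].
  assert (Hin : In (i, negb b) u).
  { apply NNPP. intro Hno.
    (* With [f] the indicator of [i]: if the inverse letter is absent, every occurrence of [i] has
       the sign of the first, and the sum cannot vanish. *)
    set (f := fun j : I => if excluded_middle_informative (i = j) then 1%Z else 0%Z).
    specialize (Hu f). simpl in Hu.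
    assert (Hpos : (0 <= (if b then wsum f u else - wsum f u))%Z).
    { clear - Hno. induction u as [|[j c] u IHu]; [now destruct b|].
      assert (Hno' : ~ In (i, negb b) u) by (intro; apply Hno; now right).
      assert (Hj : (j, c) <> (i, negb b)) by (intro; apply Hno; now left).
      specialize (IHu Hno'). simpl.
      assert (Hf : f j = 0%Z \/ f j = 1%Z /\ i = j).
      { unfold f. destruct excluded_middle_informative; auto. }
      destruct Hf as [->|[-> <-]]; destruct b, c; simpl in Hj; try lia; now destruct Hj. }
    assert (Hf : f i = 1%Z).
    { unfold f. destruct excluded_middle_informative; easy. }
    rewrite Hf in Hu. destruct b; lia. }
  apply in_split in Hin. destruct Hin as (u1 & u2 & ->).
  assert (E : ev t (u1 ++ u2) = 1).
  { apply (IH (length (u1 ++ u2))); auto.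
    - subst n. simpl. rewrite !length_app. simpl. lia.
    - intro f. specialize (Hu f). simpl in Hu. rewrite wsum_app in *. simpl in Hu.
      destruct b; simpl in Hu; lia. }
  rewrite ev_app in E. simpl. rewrite ev_app. simpl.
  rewrite (gmulA _ (ev t u1)), <- (Hb i (negb b)), <- gmulA, E.
  destruct b; simpl; grp.
Qed.
End Eval.

(** * The finite group, as words modulo [weq] *)

Section Construction.
Variables (G : Group) (t : I -> G) (e : nat).
Hypothesis pow_central : forall g : G, in_center (gpow g e).
Hypothesis powM : forall g h : G, gpow (g * h) e = gpow g e * gpow h e.

(* [w] and [w'] agree in the quotient of [G * Z^I] by the central subgroup of the
   [(ev u ^ e, e * wsum u)], where [i : I] maps to [(t i, delta_i)]. *)
Definition weq (w w' : word) : Prop := exists u,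
  ev t w = ev t w' * gpow (ev t u) e /\
  forall f, wsum f w = (wsum f w' + Z.of_nat e * wsum f u)%Z.

Lemma powV (g : G) : gpow (g^-) e = (gpow g e)^-.
Proof.
  apply (gmul_cancel_l (x := gpow g e)). now rewrite <- powM, !gmulVr, gpow1.
Qed.

(** Taking [e]-th powers is an endomorphism, so it may be applied letter by letter. The value
    becomes a word in the central elements [gpow (t i) e]. *)
Lemma ev_pow_exp u : ev (fun i => gpow (t i) e) u = gpow (ev t u) e.
Proof.
  induction u as [|[i b] u IH]; simpl; [now rewrite gpow1|].
  rewrite powM, IH. destruct b; [easy | now rewrite powV].
Qed.

Lemma weq_ev w w' : ev t w = ev t w' -> (forall f, wsum f w = wsum f w') -> weq w w'.
Proof.
  intros E S. exists []. simpl. rewrite gpow1, gmul1r. split; auto. intro f. rewrite S. lia.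
Qed.

Lemma weq_sym w w' : weq w w' -> weq w' w.
Proof.
  intros (u & E & S). exists (winv u). split.
  - rewrite E, ev_inv, powV. grp.
  - intro f. rewrite S, wsum_inv. lia.
Qed.

Lemma weq_trans w1 w2 w3 : weq w1 w2 -> weq w2 w3 -> weq w1 w3.
Proof.
  intros (u & E & S) (v & E' & S'). exists (v ++ u). split.
  - now rewrite E, E', ev_app, powM, gmulA.
  - intro f. rewrite S, S', wsum_app. lia.
Qed.

Lemma weq_app w1 w1' w2 w2' : weq w1 w1' -> weq w2 w2' -> weq (w1 ++ w2) (w1' ++ w2').
Proof.
  intros (u & E & S) (v & E' & S'). exists (u ++ v). split.
  - rewrite !ev_app, E, E', powM, <- !gmulA. f_equal.
    rewrite (gmulA _ (gpow _ _)), (pow_central (ev t u) (ev t w2')). grp.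
  - intro f. rewrite !wsum_app, S, S'. lia.
Qed.

(** This is the subgroup generated by the images of the [(t i, delta_i)]; taking words modulo [weq]
    yields it without forming the ambient quotient. *)
Lemma exists_word_group : exists (K : Group) (p : word -> K),
  (forall k, exists w, p w = k) /\ (forall a b, p (a ++ b) = p a * p b) /\
  (forall a b, p a = p b <-> weq a b).
Proof.
  apply quotient_group with (mul := @app (I * bool)) (one := []) (inv := winv).
  - intro. now apply weq_ev.
  - exact weq_sym.
  - exact weq_trans.
  - exact weq_app.
  - intros a b c. rewrite app_assoc. now apply weq_ev.
  - intro. now apply weq_ev.
  - intro a. apply weq_ev.
    + rewrite ev_app, ev_inv. simpl. grp.
    + intro f. rewrite wsum_app, wsum_inv. simpl. lia.
Qed.

Section WordGroup.
Variables (K : Group) (p : word -> K).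
Hypothesis e_pos : 0 < e.
Hypothesis t_total : forall g, exists i, modZ (t i) g.
Hypothesis p_surj : forall k, exists w, p w = k.
Hypothesis p_app : forall a b, p (a ++ b) = p a * p b.
Hypothesis p_eq : forall a b, p a = p b <-> weq a b.

Lemma p_nil : p [] = 1.
Proof. apply (gmul_cancel_l (x := p [])). rewrite <- p_app. grp. Qed.

Lemma p_inv w : p (winv w) = (p w)^-.
Proof.
  apply (gmul_cancel_l (x := p w)). rewrite <- p_app, gmulVr, <- p_nil.
  apply p_eq, weq_ev.
  - rewrite ev_app, ev_inv. simpl. grp.
  - intro f. rewrite wsum_app, wsum_inv. simpl. lia.
Qed.

Lemma p_wpow w n : p (wpow w n) = gpow (p w) n.
Proof. induction n as [|n IH]; simpl; [apply p_nil|]. now rewrite p_app, IH. Qed.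

Lemma word_group_exp (k : K) : gpow k e = 1.
Proof.
  destruct (p_surj k) as [w <-]. rewrite <- p_wpow, <- p_nil. apply p_eq.
  (* The witness is [w] itself: its [e]-th power is the relator attached to [w]. *)
  exists w. simpl. rewrite ev_pow, gmul1. split; [easy|]. intro f. now rewrite wsum_pow.
Qed.

(** [Z^I] is abelian, so only the component in [G] can obstruct commutation. *)
Lemma p_central w : in_center (ev t w) -> in_center (p w).
Proof.
  intros H k. destruct (p_surj k) as [v <-]. rewrite <- !p_app. apply p_eq, weq_ev.
  - rewrite !ev_app. apply H.
  - intro f. rewrite !wsum_app. lia.
Qed.

(** A class determines the value in [G] only up to central [e]-th powers, so the projection is a
    mere relation. It becomes single-valued and injective on derived subgroups, where exponent sums
    vanish. *)
Lemma word_group_isoclinism :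
  isoclinism (fun (k : K) (g : G) => exists w, p w = k /\ ev t w = g).
Proof.
  constructor.
  - intros ? ? ? ? (w & <- & <-) (w' & <- & <-). exists (w ++ w').
    now rewrite p_app, ev_app.
  - intros ? ? (w & <- & <-). exists (winv w). now rewrite p_inv, ev_inv.
  - intro k. destruct (p_surj k) as [w <-]. exists (ev t w), (p w).
    split; [apply modZ_refl | now exists w].
  - intro g. destruct (t_total g) as [i Hi]. exists (p [(i, true)]), (t i).
    split; [now apply modZ_sym|]. exists [(i, true)]. simpl. now rewrite gmul1r.
  - intros k g D.
    assert (E : exists w, p w = k /\ ev t w = g /\ forall f, wsum f w = 0%Z).
    { induction D as [? ? ? ? (a & <- & <-) (b & <- & <-)| |
        ? ? ? ? D (a & <- & <- & Ha) D' (b & <- & <- & Hb)|? ? D (a & <- & <- & Ha)].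
      - exists ((winv a ++ winv b) ++ (a ++ b)). unfold comm.
        rewrite !p_app, !ev_app, !p_inv, !ev_inv. repeat split.
        intro f. rewrite !wsum_app, !wsum_inv. lia.
      - exists []. repeat split. apply p_nil.
      - exists (a ++ b). rewrite p_app, ev_app. repeat split. intro f.
        now rewrite wsum_app, Ha, Hb.
      - exists (winv a). rewrite p_inv, ev_inv. repeat split. intro f.
        now rewrite wsum_inv, Ha. }
    destruct E as (w & <- & <- & Hw). split; intro E.
    (* Triviality in [K] gives [u] with [ev t w = gpow (ev t u) e] and [e * wsum f u = 0] for all
       [f]; as [e > 0], the sums of [u] vanish, so the corresponding word in the central
       [gpow (t i) e] is trivial. *)
    + rewrite <- p_nil in E. apply p_eq in E. destruct E as (u & E & S).
      simpl in E. rewrite gmul1 in E. rewrite E, <- ev_pow_exp.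
      apply ev_central_wsum0; [intro; apply pow_central|].
      intro f. specialize (S f). rewrite Hw in S. simpl in S. nia.
    + rewrite <- p_nil. apply p_eq, weq_ev; auto.
Qed.

(** Normal forms [c1^n1 ... ck^nk] with [0 <= ni < e]. When the [ci] are central these fill the
    subgroup they generate, because [K] has exponent dividing [e]. *)
Fixpoint prods (cs : list K) : list K :=
  match cs with
  | [] => [1]
  | c :: cs => flat_map (fun n => map (gmul (gpow c n)) (prods cs)) (seq 0 e)
  end.

Lemma prods_length cs : length (prods cs) = Nat.pow e (length cs).
Proof.
  induction cs as [|c cs IH]; simpl; [easy|].
  rewrite flat_map_constant_length with (c := length (prods cs)).
  - now rewrite length_seq, IH.
  - intros. apply length_map.
Qed.

Lemma prods_mul cs c x : (forall c, In c cs -> in_center c) ->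
  In c cs -> In x (prods cs) -> In (c * x) (prods cs).
Proof.
  revert x. induction cs as [|d cs IH]; intros x Hc Hin Hx; [easy|].
  simpl in Hx. apply in_flat_map in Hx. destruct Hx as (n & Hn & Hx).
  apply in_seq in Hn. apply in_map_iff in Hx. destruct Hx as (y & <- & Hy).
  simpl. apply in_flat_map. destruct Hin as [->|Hin].
  (* Exponents wrap around: [e - 1] is followed by [0], since [gpow c e = 1]. *)
  - destruct (Nat.eq_dec (S n) e) as [Hne|Hne].
    + exists 0. split; [apply in_seq; lia|]. apply in_map_iff. exists y. split; [|easy].
      rewrite gmulA. change (c * gpow c n) with (gpow c (S n)).
      now rewrite Hne, word_group_exp.
    + exists (S n). split; [apply in_seq; lia|]. apply in_map_iff. exists y.
      split; [simpl; grp | easy].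
  - exists n. split; [apply in_seq; lia|]. apply in_map_iff. exists (c * y). split.
    + rewrite !gmulA. f_equal. symmetry. apply Hc. now right.
    + apply IH; auto using in_cons.
Qed.

Lemma word_group_finite (E : list I) : (forall i, In i E) ->
  exists l : list K, (forall k, In k l) /\
    length l = (length E * Nat.pow e (length E * length E))%nat.
Proof.
  intro HE. set (g := fun i => p [(i, true)]).
  assert (Hl : forall ij : I * I, exists l, modZ (t l) (t (fst ij) * t (snd ij))).
  { intro ij. apply t_total. }
  destruct (choose_fun Hl) as [m Hm].
  (* The defect [c (i, j)] is central because [t (m (i, j))] represents [t i * t j] modulo the
     centre. *)
  set (c := fun ij : I * I => g (fst ij) * g (snd ij) * (g (m ij))^-).
  assert (Hc : forall ij, in_center (c ij)).
  { intros [i j]. unfold c, g. rewrite <- p_inv, <- !p_app. apply p_central.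
    rewrite !ev_app, ev_inv. simpl. rewrite !gmul1r.
    specialize (Hm (i, j)). simpl in Hm. apply modZP in Hm. destruct Hm as (z & Hz & ->).
    now rewrite <- (Hz (t (m (i, j)))), <- gmulA, gmulVr, gmul1r. }
  set (cs := map c (list_prod E E)).
  set (S := flat_map (fun i => map (gmul (g i)) (prods cs)) E).
  (* Here [g i * g j * y = g (m (i, j)) * (c (i, j) * y)], and [prods cs] absorbs [c (i, j)]. *)
  assert (HS : forall i x, In x S -> In (g i * x) S).
  { intros i x Hx. apply in_flat_map in Hx. destruct Hx as (j & _ & Hx).
    apply in_map_iff in Hx. destruct Hx as (y & <- & Hy).
    apply in_flat_map. exists (m (i, j)). split; [apply HE|].
    apply in_map_iff. exists (c (i, j) * y). split.
    - rewrite gmulA, <- (Hc (i, j) (g (m (i, j)))). unfold c. simpl. grp.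
    - apply prods_mul; auto.
      + intros d Hd. apply in_map_iff in Hd. destruct Hd as (ij & <- & _). apply Hc.
      + apply in_map, in_prod; apply HE. }
  assert (HSpow : forall i n x, In x S -> In (gpow (g i) n * x) S).
  { intros i n x Hx. induction n as [|n IH]; simpl; [now rewrite gmul1|].
    rewrite <- gmulA. auto. }
  destruct (t_total 1) as [i0 _].
  (* Any [s0] in [S] serves: by closure under generators all [k * s0] lie in [S], and translating
     back by [s0^-] enumerates [K]. *)
  assert (Hs0 : exists s0, In s0 S).
  { assert (Hp : exists x, In x (prods cs)).
    { destruct (prods cs) as [|x l] eqn:El; [|exists x; apply in_eq].
      pose proof (prods_length cs) as Hlen. rewrite El in Hlen. simpl in Hlen.
      symmetry in Hlen. apply Nat.pow_eq_0_iff in Hlen. lia. }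
    destruct Hp as [x Hx]. exists (g i0 * x). apply in_flat_map. exists i0.
    split; [apply HE | now apply in_map]. }
  destruct Hs0 as [s0 Hs0].
  assert (Hall : forall w, In (p w * s0) S).
  { induction w as [|[i b] w IH]; [now rewrite p_nil, gmul1|].
    change ((i, b) :: w) with ([(i, b)] ++ w). rewrite p_app, <- gmulA.
    destruct b; [now apply HS|].
    (* Since [gpow (g i) e = 1], the inverse of [g i] is its power of exponent [e - 1]. *)
    replace (p [(i, false)]) with (gpow (g i) (e - 1)); [now apply HSpow|].
    change [(i, false)] with (winv [(i, true)]). rewrite p_inv. fold (g i).
    apply (gmul_cancel_l (x := g i)). rewrite gmulVr, <- (word_group_exp (g i)).
    replace e with (Datatypes.S (e - 1)) at 2 by lia. reflexivity. }
  exists (map (fun x => x * s0^-) S). split.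
  - intro k. destruct (p_surj k) as [w <-]. apply in_map_iff.
    exists (p w * s0). split; [grp | apply Hall].
  - rewrite length_map. unfold S.
    rewrite flat_map_constant_length with (c := length (prods cs)) by (intros; apply length_map).
    rewrite prods_length. unfold cs. now rewrite length_map, length_prod.
Qed.
End WordGroup.
End Construction.
End Words.

Lemma finite_isoclinic n : exists B, forall G : Group, omega_eq G n ->
  exists (K : Group) (l : list K) (r : K -> G -> Prop),
    length l = B /\ (forall k, In k l) /\ isoclinism r.
Proof.
  destruct (central_power_hom n) as [M HM]. exists (M * Nat.pow M (M * M))%nat.
  intros G HG. destruct (HM G HG) as (T & e & HT & He & Htot & Hc & Hp).
  set (I := {x : G | In x T}). set (t := fun i : I => proj1_sig i).
  assert (Htot' : forall g, exists i, modZ (t i) g).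
  { intro g. destruct (Htot g) as (x & Hx & Hg). now exists (exist _ x Hx). }
  assert (HE : exists E : list I, (forall i, In i E) /\ length E <= length T).
  { assert (H : forall T', incl T' T -> exists E : list I,
      (forall i : I, In (proj1_sig i) T' -> In i E) /\ length E <= length T').
    { induction T' as [|x T' IH]; intro Hi.
      - exists []. split; [easy | simpl; lia].
      - destruct IH as (E & HE & HL); [intros y Hy; apply Hi; now right|].
        exists (exist _ x (Hi x (in_eq _ _)) :: E). split; [|simpl; lia].
        intros [y Hy] [Hxy|Hin]; [left | right; now apply HE].
        now apply sig_eq. }
    destruct (H T (incl_refl T)) as (E & HE & HL). exists E. split; auto.
    intros [x Hx]. now apply HE. }
  destruct HE as (E & HE & HL).
  destruct (exists_word_group t Hc Hp) as (K & p & Hs & Ha & Hq).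
  destruct (word_group_finite (proj1 He) Htot' Hs Ha Hq HE) as (l & Hl & Hll).
  (* Padding with [1] brings every enumeration to the same length, which makes multiplication tables
     comparable; repetitions are allowed. *)
  exists K, (l ++ repeat 1 (M * Nat.pow M (M * M) - length l)),
    (fun k g => exists w, p w = k /\ ev t w = g).
  split; [|split].
  - rewrite length_app, repeat_length.
    enough (length l <= M * Nat.pow M (M * M))%nat by lia. rewrite Hll.
    apply Nat.mul_le_mono; [lia|].
    transitivity (Nat.pow M (length E * length E)); [apply Nat.pow_le_mono_l; lia|].
    apply Nat.pow_le_mono_r; [lia|]. apply Nat.mul_le_mono; lia.
  - intro k. apply in_or_app. left. apply Hl.
  - apply (word_group_isoclinism Hc Hp (proj1 He) Htot' Hs Ha Hq).
Qed.

(** * Finitely many groups of bounded order *)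

(** Splitting [S] by each [P] in turn, and keeping one element of each nonempty part, gives a
    representative of every realised truth pattern. *)
Lemma finitely_many_types (A : Type) (Ps : list (A -> Prop)) (S : A -> Prop) :
  exists L : list A, (forall b, In b L -> S b) /\
    forall a, S a -> exists b, In b L /\ forall P, In P Ps -> P a <-> P b.
Proof.
  revert S. induction Ps as [|P Ps IH]; intro S.
  - destruct (classic (exists b, S b)) as [[b Hb]|Hno].
    + exists [b]. split; [now intros ? [<-|[]]|]. intros a _. exists b.
      split; [apply in_eq | easy].
    + exists []. split; [easy|]. intros a Ha. exfalso. apply Hno. now exists a.
  - destruct (IH (fun a => S a /\ P a)) as (L1 & H1 & H1').
    destruct (IH (fun a => S a /\ ~ P a)) as (L2 & H2 & H2').
    exists (L1 ++ L2). split.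
    + intros b Hb. apply in_app_or in Hb. destruct Hb as [Hb|Hb]; [now apply H1 | now apply H2].
    + intros a Ha. destruct (classic (P a)) as [HP|HP].
      * destruct (H1' a (conj Ha HP)) as (b & Hb & E). exists b.
        split; [apply in_or_app; now left|]. intros Q [<-|HQ]; [|auto].
        specialize (H1 b Hb). tauto.
      * destruct (H2' a (conj Ha HP)) as (b & Hb & E). exists b.
        split; [apply in_or_app; now right|]. intros Q [<-|HQ]; [|auto].
        specialize (H2 b Hb). tauto.
Qed.

(** The enumerations may repeat elements, but the table also decides which entries coincide, so
    matching indices is well defined and bijective. *)
Lemma same_table_iso (K L : Group) (k : list K) (l : list L) :
  length k = length l -> (forall x, In x k) -> (forall x, In x l) ->
  (forall a b c, a < length k -> b < length k -> c < length k ->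
     nth a k 1 * nth b k 1 = nth c k 1 <-> nth a l 1 * nth b l 1 = nth c l 1) ->
  exists f : K -> L, (forall x y, f (x * y) = f x * f y) /\
    (forall x y, f x = f y -> x = y) /\ (forall z, exists x, f x = z).
Proof.
  intros Hlen Hk Hl Htab.
  assert (Hidx : forall x, exists a, a < length k /\ nth a k 1 = x).
  { intro x. apply In_nth, Hk. }
  destruct (choose_fun Hidx) as [idx Hi].
  assert (idx_lt : forall x, idx x < length k) by (intro x; apply Hi).
  assert (idxK : forall x, nth (idx x) k 1 = x) by (intro x; apply Hi).
  assert (f1 : nth (idx 1) l 1 = 1).
  { assert (E : nth (idx 1) k 1 * nth (idx 1) k 1 = nth (idx 1) k 1).
    { rewrite idxK. grp. }
    apply Htab in E; auto. apply (gmul_cancel_l (x := nth (idx 1) l 1)).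
    rewrite E. grp. }
  (* Equality of two entries is a table entry, that of multiplication by [1]; the index of [1] in
     [k] also gives [1] in [l]. *)
  assert (Heq : forall a b, a < length k -> b < length k ->
    nth a k 1 = nth b k 1 <-> nth a l 1 = nth b l 1).
  { intros a b Ha Hb. rewrite <- (gmul1r (nth a k 1)), <- (gmul1r (nth a l 1)).
    rewrite <- f1 at 2. rewrite <- (idxK 1) at 2. now apply Htab. }
  exists (fun x => nth (idx x) l 1). repeat split.
  - intros x y. symmetry. apply Htab; auto. now rewrite !idxK.
  - intros x y E. apply Heq in E; auto. now rewrite !idxK in E.
  - intro z. destruct (In_nth _ _ 1 (Hl z)) as (a & Ha & <-).
    exists (nth a k 1). apply Heq; auto; lia.
Qed.

Lemma finitely_many_groups B : exists L : list Group,
  forall (K : Group) (k : list K), length k = B -> (forall x, In x k) ->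
  exists K', In K' L /\ exists f : K -> K', (forall x y, f (x * y) = f x * f y) /\
    (forall x y, f x = f y -> x = y) /\ (forall z, exists x, f x = z).
Proof.
  (* A triple of indices records one entry of the multiplication table, so enumerations of length
     [B] realise finitely many patterns. *)
  set (P := fun (abc : nat * (nat * nat)) (Kk : {K : Group & list K}) =>
    nth (fst abc) (projT2 Kk) 1 * nth (fst (snd abc)) (projT2 Kk) 1
      = nth (snd (snd abc)) (projT2 Kk) 1).
  set (s := seq 0 B).
  destruct (@finitely_many_types {K : Group & list K}
    (map P (list_prod s (list_prod s s)))
    (fun Kk => length (projT2 Kk) = B /\ forall x, In x (projT2 Kk))) as (L & HL & H).
  exists (map (@projT1 _ _) L). intros K k Hk Hall.
  destruct (H (existT _ K k)) as ([K' k'] & Hin & HP); [easy|].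
  destruct (HL _ Hin) as [Hk' Hall']. simpl in *.
  exists K'. split; [apply in_map_iff; now exists (existT _ K' k')|].
  apply (@same_table_iso K K' k k'); [congruence | easy | easy |].
  intros a b c Ha Hb Hc. apply (HP (P (a, (b, c)))). apply in_map.
  repeat apply in_prod; apply in_seq; lia.
Qed.

Theorem theorem1p1 (n : nat) (G : Group) :
  0 < n -> omega_eq G n ->
  (exists L : list Group,
      forall H : Group, omega_eq H n -> exists K, In K L /\ isoclinic H K)
  /\
  (exists K : Group, finite_group K /\ isoclinic K G /\ omega_eq K n).
Proof.
  intros _ HG. destruct (finite_isoclinic n) as [B HB]. split.
  - destruct (finitely_many_groups B) as [L HL]. exists L. intros H HH.
    destruct (HB H HH) as (K & k & r & Hk & Hall & Hr).
    destruct (HL K k Hk Hall) as (K' & HK' & f & fM & finj & fsurj).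
    exists K'. split; [easy|]. eapply isoclinism_isoclinic.
    apply (isoclinism_trans_iso (isoclinism_sym Hr) fM finj fsurj).
  - destruct (HB G HG) as (K & k & r & Hk & Hall & Hr). exists K. split; [|split].
    + now exists k.
    + apply (isoclinism_isoclinic Hr).
    + apply (isoclinism_omega (isoclinism_sym Hr) HG).
Qed.
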